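(* Let $E/\mathbb{Q}$ be the elliptic curve defined by $y^2=x^3-x$. For each non-zero integer $r$, the Hardy--Littlewood conjecture (HL) implies $$\pi_{E,r}(x)\sim\frac12\prod_{p\nmid r}\Big(1-\frac{(\frac{-1}{p})}{p-1}\Big)\cdot\frac{\sqrt x}{\log x}$$ if $r\equiv2\ (\mathrm{mod}\ 4)$, and $\pi_{E,r}(x)=O(1)$ otherwise.
   Context: For $E/\mathbb{Q}$ of conductor $N_E$ and $p\nmid N_E$, $a_p(E)=p+1-|E_p(\mathbb{F}_p)|$, $\pi_{E,r}(x)=|\{p\leqslant x: p\nmid N_E,\ a_p(E)=r\}|$. $(\frac{\cdot}{p})$ is the Legendre symbol; infinite products over primes are in increasing order. (HL): for all $a,b,c\in\mathbb{Z}$ with $a>0$, $b^2-4ac$ not a square, $\gcd(a,b,c)=1$, and $a+b$, $c$ not both even, the number $\pi_{a,b,c}(x)$ of primes $p\leqslant x$ of the form $am^2+bm+c$, $m\in\mathbb{Z}_{\geqslant1}$, satisfies $\pi_{a,b,c}(x)\sim\frac{\gcd(2,a+b)}{\sqrt a}\frac{\Delta}{\varphi(\Delta)}\prod_{p\nmid2a}\Big(1-\frac{(\frac{b^2-4ac}{p})}{p-1}\Big)\frac{\sqrt x}{\log x}$, $\Delta$ being the odd part of $\gcd(a,b)$. *)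

(* Defs.v *)
From HB Require Import structures.
From mathcomp Require Import all_boot all_order all_algebra.
From mathcomp Require Import all_classical all_reals all_analysis.

Set Implicit Arguments.
Unset Strict Implicit.
Unset Printing Implicit Defensive.

Import Order.TTheory GRing.Theory Num.Theory.
Import numFieldNormedType.Exports.

Local Open Scope ring_scope.
Local Open Scope classical_set_scope.

Definition asymptotic (R : realType) (f g : R -> R) : Prop :=
  f x / g x @[x --> +oo] --> (1 : R).

Definition is_bigO (R : realType) (f g : R -> R) : Prop :=
  exists C : R, \forall x \near +oo, `|f x| <= C * `|g x|.

(* y^2 + a1 x y + a3 y = x^3 + a2 x^2 + a4 x + a6 *)
Record weierstrass (K : Type) := Weierstrass {
  wa1 : K; wa2 : K; wa3 : K; wa4 : K; wa6 : K }.

Definition map_weierstrass (K L : Type) (f : K -> L) (W : weierstrass K) :=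
  Weierstrass (f (wa1 W)) (f (wa2 W)) (f (wa3 W)) (f (wa4 W)) (f (wa6 W)).

Definition wdisc (K : comNzRingType) (W : weierstrass K) : K :=
  let: Weierstrass a1 a2 a3 a4 a6 := W in
  let b2 := a1 ^+ 2 + 4%:R * a2 in
  let b4 := 2%:R * a4 + a1 * a3 in
  let b6 := a3 ^+ 2 + 4%:R * a6 in
  let b8 := a1 ^+ 2 * a6 + 4%:R * a2 * a6 - a1 * a3 * a4 + a2 * a3 ^+ 2
            - a4 ^+ 2 in
  - b2 ^+ 2 * b8 - 8%:R * b4 ^+ 3 - 27%:R * b6 ^+ 2 + 9%:R * b2 * b4 * b6.

(* The substitution x = u^2 x' + r, y = u^3 y' + s u^2 x' + t turns W into W'. *)
Definition weierstrass_iso (K : fieldType) (W W' : weierstrass K) : Prop :=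
  exists u r s t : K, u != 0 /\
    [/\ u * wa1 W' = wa1 W + 2%:R * s,
        u ^+ 2 * wa2 W' = wa2 W - s * wa1 W + 3%:R * r - s ^+ 2,
        u ^+ 3 * wa3 W' = wa3 W + r * wa1 W + 2%:R * t,
        u ^+ 4 * wa4 W' = wa4 W - s * wa3 W + 2%:R * r * wa2 W
                          - (t + r * s) * wa1 W + 3%:R * r ^+ 2
                          - 2%:R * s * t
      & u ^+ 6 * wa6 W' = wa6 W + r * wa4 W + r ^+ 2 * wa2 W + r ^+ 3
                          - t * wa3 W - t ^+ 2 - r * t * wa1 W].

Definition over_rat : weierstrass int -> weierstrass rat :=
  map_weierstrass (fun z : int => z%:~R : rat).

(* The primes not dividing the conductor N_E are the primes of good reduction:
   those at which some integral model over Q has unit discriminant. *)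
Definition good_reduction (E : weierstrass int) (p : nat) : Prop :=
  exists2 W : weierstrass int,
    weierstrass_iso (over_rat E) (over_rat W) & ~~ (p%:Z %| wdisc W)%Z.

Definition on_weierstrass (K : comNzRingType) (W : weierstrass K)
    (P : K * K) : bool :=
  let: (x, y) := P in
  y ^+ 2 + wa1 W * x * y + wa3 W * y
    == x ^+ 3 + wa2 W * x ^+ 2 + wa4 W * x + wa6 W.

(* |E_p(F_p)|, with one point at infinity. The equation E itself is reduced, so
   E has to be minimal at p; y^2 = x^3 - x, of discriminant 64, is so at every
   odd p. *)
Definition card_reduction (E : weierstrass int) (p : nat) : nat :=
  #|on_weierstrass (map_weierstrass (fun z : int => z%:~R : 'F_p) E)|.+1.

Definition frob_trace (E : weierstrass int) (p : nat) : int :=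
  p%:Z + 1 - (card_reduction E p)%:Z.

Definition count_primes (R : realType) (P : nat -> Prop) (x : R) : R :=
  (\sum_(0 <= p < (Num.truncn x).+1 | prime p && `[< P p >]) 1)%N%:R.

Definition pi_trace (R : realType) (E : weierstrass int) (r : int) : R -> R :=
  count_primes (fun p => good_reduction E p /\ frob_trace E p = r).

Definition curve_x3_sub_x : weierstrass int := Weierstrass 0 0 0 (-1) 0.

(* Only meaningful for p an odd prime. *)
Definition legendre (a : int) (p : nat) : int :=
  if (p%:Z %| a)%Z then 0
  else if [exists y : 'F_p, y ^+ 2 == a%:~R] then 1 else -1.

(* The product over the primes p satisfying P, in increasing order, of
   1 - (d/p)/(p-1); it converges only conditionally in general. *)
Definition legendre_product (R : realType) (d : int) (P : pred nat) : R :=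
  limn (fun n : nat => \prod_(0 <= p < n | prime p && P p)
          (1 - (legendre d p)%:~R / (p%:R - 1)) : R).

Definition pi_quadratic (R : realType) (a b c : int) : R -> R :=
  count_primes (fun p => exists2 m : int, 1 <= m & p%:Z = a * m ^+ 2 + b * m + c).

Definition odd_gcd (a b : int) : nat := ((gcdn `|a| `|b|)`_(2^'))%N.

Definition hardy_littlewood (R : realType) : Prop :=
  forall a b c : int,
    0 < a ->
    ~ (exists k : int, b ^+ 2 - 4%:R * a * c = k ^+ 2) ->
    gcdz (gcdz a b) c = 1 ->
    ~ ((2 %| a + b)%Z /\ (2 %| c)%Z) ->
    asymptotic (@pi_quadratic R a b c)
      (fun x : R => (gcdz 2 (a + b))%:~R / Num.sqrt (a%:~R)
         * ((odd_gcd a b)%:R / (totient (odd_gcd a b))%:R)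
         * legendre_product R (b ^+ 2 - 4%:R * a * c)
             (fun p => ~~ (p%:Z %| 2 * a)%Z)
         * (Num.sqrt x / ln x)).

(* Main.v *)
(* Write [chi] for the quadratic character of F_p and
   [J k = \sum_x chi (x * (x ^+ 2 + k))], so that a_p(E) = - J (-1).
   Replacing x by -x gives J = 0 when p = 3 mod 4. When p = 1 mod 4, averaging
   J(k)^2 over k yields Jacobsthal's identity J(-1)^2 + J(n)^2 = 4p for a
   nonresidue n, and counting orbits of the group generated by x -> -x and
   x -> 1/x gives J(-1) = 7 - p mod 8. Hence a_p(E) = 2a, where p = a^2 + b^2
   and 2a = p + 1 mod 8; this determines a by uniqueness of the representation
   of p as a sum of two squares. So for r = 2a with a odd, the primes with
   a_p(E) = r are exactly those of the form 16m^2 + a^2 with m >= 1 if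
   a = 1 mod 4, and (4m - 2)^2 + a^2 if a = 3 mod 4, and (HL) applies to these
   quadratic polynomials; for other nonzero r there are none. *)
Require Import Defs.
From mathcomp Require Import all_boot all_order all_algebra.
From mathcomp Require Import all_classical all_reals all_analysis.
From mathcomp Require Import finfield zify ring.
Set Implicit Arguments.
Unset Strict Implicit.
Unset Printing Implicit Defensive.
Import Order.TTheory GRing.Theory Num.Theory.
Import numFieldNormedType.Exports.
Local Open Scope ring_scope.

(** * Jacobsthal sums over finite fields *)

(** The quadratic character in odd characteristic. Encoded by counting square roots, so that summing
    it over [x] counts the points of a curve [y^2 = f(x)]. *)
Definition qchar (F : finFieldType) (x : F) : int :=
  #|[pred y : F | y ^+ 2 == x]|%:Z - 1.

Lemma sum_mull (F : finFieldType) (n : F) (f : F -> int) :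
  n != 0 -> \sum_x f (n * x) = \sum_x f x.
Proof. by move=> n0; symmetry; apply: reindex_inj; apply: mulfI. Qed.

Lemma sum_addl (F : finFieldType) (n : F) (f : F -> int) :
  \sum_x f (n + x) = \sum_x f x.
Proof. by symmetry; apply: reindex_inj; apply: addrI. Qed.

Lemma sum_opp (F : finFieldType) (f : F -> int) : \sum_x f (- x) = \sum_x f x.
Proof. by symmetry; apply: reindex_inj; apply: oppr_inj. Qed.

Lemma sum_inv (F : finFieldType) (f : F -> int) : \sum_x f x^-1 = \sum_x f x.
Proof. by symmetry; apply: reindex_inj; apply: invr_inj. Qed.

Lemma opp_neq (F : finFieldType) (x : F) : 2 != 0 :> F -> x != 0 -> x != - x.
Proof. by move=> F2 x0; rewrite -addr_eq0 -mulr2n -mulr_natl mulf_neq0. Qed.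

Lemma qchar0 (F : finFieldType) : qchar (0 : F) = 0.
Proof.
rewrite /qchar (eq_card (B := pred1 (0 : F))) ?card1 // => y.
by rewrite !inE expf_eq0.
Qed.

Lemma qchar_sqr (F : finFieldType) (t : F) :
  2 != 0 :> F -> t != 0 -> qchar (t ^+ 2) = 1.
Proof.
move=> F2 t0; rewrite /qchar (eq_card (B := pred2 t (- t))) ?card2 ?opp_neq //.
by move=> y; rewrite !inE eqf_sqr.
Qed.

Lemma qchar1 (F : finFieldType) : 2 != 0 :> F -> qchar (1 : F) = 1.
Proof. by move=> F2; rewrite -(expr1n _ 2) qchar_sqr ?oner_eq0. Qed.

Variant qchar_spec (F : finFieldType) (x : F) : int -> Prop :=
| QcharZero of x = 0 : qchar_spec x 0
| QcharSqr t of t != 0 & x = t ^+ 2 : qchar_spec x 1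
| QcharNonsqr of x != 0 & (forall t, t ^+ 2 != x) : qchar_spec x (-1).

Lemma qcharP (F : finFieldType) (x : F) :
  2 != 0 :> F -> qchar_spec x (qchar x).
Proof.
move=> F2; have [->|x0] := eqVneq x 0; first by rewrite qchar0; constructor.
case: (pickP [pred y : F | y ^+ 2 == x]) => [t /eqP /= tx|nsq].
  have t0 : t != 0 by apply: contraNneq x0 => t0; rewrite -tx t0 expr0n.
  by rewrite -tx qchar_sqr //; apply: QcharSqr t0 _.
rewrite /qchar (eq_card0 nsq); apply: QcharNonsqr x0 _ => t.
by have /= -> := nsq t.
Qed.

Lemma qchar_mul_sqr (F : finFieldType) (x t : F) :
  t != 0 -> qchar (t ^+ 2 * x) = qchar x.
Proof.
move=> t0; rewrite /qchar; congr (Posz _ - 1).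
rewrite -(fintype.card_image (mulfI t0) [pred y | y ^+ 2 == x]).
apply: eq_card => y; rewrite inE /=; apply/idP/fintype.imageP => [/eqP yE|[z]].
  exists (t^-1 * y); last by rewrite mulVKf.
  by rewrite inE exprMn yE exprVn mulKf // expf_neq0.
by rewrite inE => /eqP <- ->; rewrite exprMn.
Qed.

(** Each [y] is a square root of exactly one [x]. *)
Lemma sum_qchar (F : finFieldType) : \sum_(x : F) qchar x = 0.
Proof.
rewrite sumrB sumr_const -(raddf_sum Posz) /=.
have -> : (\sum_(x : F) #|[pred y : F | y ^+ 2 == x]| = #|F|)%N.
  rewrite -[RHS]sum1_card [RHS](partition_big (fun y : F => y ^+ 2) xpredT) //=.
  by apply: eq_bigr => x _; rewrite -sum1_card.
by rewrite natz subrr.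
Qed.

(* For a nonresidue [n], the terms of [\sum_x (qchar (n * x) + qchar x) = 0]
   are all nonpositive, hence all zero. *)
Lemma qcharM (F : finFieldType) (x y : F) :
  2 != 0 :> F -> qchar (x * y) = qchar x * qchar y.
Proof.
move=> F2; case: (qcharP x F2) => [->|t t0 ->|n0 nsq].
- by rewrite !mul0r qchar0.
- by rewrite qchar_mul_sqr ?mul1r.
have nsq1 : qchar x = -1.
  case: (qcharP x F2) => // [x0|t _ xE]; first by rewrite x0 eqxx in n0.
  by have := nsq t; rewrite xE eqxx.
have le0 z : 0 <= - (qchar (x * z) + qchar z).
  case: (qcharP z F2) => [->|t t0 ->|_ _]; first by rewrite mulr0 qchar0.
    by rewrite mulrC qchar_mul_sqr // nsq1.
  by case: (qcharP (x * z) F2).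
have /eqP : \sum_z - (qchar (x * z) + qchar z) = 0.
  by rewrite sumrN big_split /= sum_mull // sum_qchar.
rewrite psumr_eq0 // => /allP /(_ y (mem_index_enum _)) /eqP.
lia.
Qed.

Lemma qchar_sum_quadratic (F : finFieldType) (u v : F) : 2 != 0 :> F ->
  \sum_k qchar ((u + k) * (v + k)) = #|F|%:Z * (u == v)%:R - 1.
Proof.
move=> F2.
have quad0 (w : F) : \sum_k qchar (k * (w + k)) = #|F|%:Z * (w == 0)%:R - 1.
  have [->|w0] := eqVneq w 0.
    under eq_bigr do rewrite add0r -expr2.
    rewrite (bigD1 (0 : F)) //= expr0n qchar0 add0r.
    under eq_bigr => k k0 do rewrite qchar_sqr //.
    rewrite sumr_const mulr1 natz (eq_card (B := predC1 (0 : F))) // cardC1.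
    by rewrite -subn1 -subzn // ltnW // card_finNzRing_gt1.
  rewrite (bigD1 (0 : F)) //= mul0r qchar0 add0r.
  (* For [k != 0], [k (w + k)] is [k^2] times [1 + w / k]. *)
  transitivity (\sum_(k : F | k != 0) qchar (1 + w * k^-1)).
    apply: eq_bigr => k k0; rewrite -(qchar_mul_sqr (1 + _) k0) //.
    by congr qchar; field.
  (* Since [0^-1 = 0], the restored term at [k = 0] is [qchar 1 = 1], the source of the [- 1]. *)
  transitivity (\sum_(k : F) qchar (1 + w * k^-1) - 1).
    by rewrite [in RHS](bigD1 (0 : F)) //= invr0 mulr0 addr0 qchar1 //
      [RHS]addrAC subrr add0r.
  rewrite (sum_inv (fun k => qchar (1 + w * k))).
  rewrite (@sum_mull F w (fun k => qchar (1 + k))) //.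
  by rewrite (sum_addl 1 (fun k => qchar k)) sum_qchar mulr0.
rewrite -subr_eq0 -[in RHS]opprB oppr_eq0 -quad0.
rewrite -(sum_addl (-u)); apply: eq_bigr => k _; congr qchar; ring.
Qed.

(** * Jacobsthal's identity *)

Definition jac (F : finFieldType) (k : F) : int :=
  \sum_x qchar (x * (x ^+ 2 + k)).

(** Substituting [t x] for [x] turns the argument into [t^2] times [t x (x^2 + k)]. *)
Lemma jac_mul_sqr (F : finFieldType) (k t : F) : 2 != 0 :> F -> t != 0 ->
  jac (t ^+ 2 * k) = qchar t * jac k.
Proof.
move=> F2 t0; rewrite /jac -(sum_mull _ t0) // mulr_sumr.
apply: eq_bigr => x _; rewrite -qcharM // -[RHS](qchar_mul_sqr _ t0) //.
by congr qchar; ring.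
Qed.

Lemma jac0 (F : finFieldType) : jac (0 : F) = 0.
Proof.
rewrite -[RHS](sum_qchar F); apply: eq_bigr => x _; rewrite addr0.
have [->|x0] := eqVneq x 0; first by rewrite mul0r.
by rewrite mulrC qchar_mul_sqr.
Qed.

Lemma jac_eq0 (F : finFieldType) (k : F) : 2 != 0 :> F ->
  qchar (-1 : F) = -1 -> jac k = 0.
Proof.
move=> F2 m1; have : jac k = - jac k.
  rewrite {1}/jac -sum_opp -sumrN; apply: eq_bigr => x _.
  by rewrite sqrrN mulNr -mulN1r qcharM // m1 mulN1r.
lia.
Qed.

(** The quotient [k / l] is a square, so by [jac_mul_sqr] the two sums differ at most in sign. *)
Lemma jac_sqr_eq (F : finFieldType) (k l : F) : 2 != 0 :> F ->
  k != 0 -> l != 0 -> qchar k = qchar l -> jac k ^+ 2 = jac l ^+ 2.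
Proof.
move=> F2 k0 l0 kl.
have kl1 : qchar (k * l) = 1.
  by rewrite qcharM // kl; case: (qcharP l F2) l0 => // ->; rewrite eqxx.
case: (qcharP (k * l) F2) kl1 => // t t0 klE _.
have -> : k = (t / l) ^+ 2 * l.
  by rewrite expr_div_n -klE; field.
have tl0 : t / l != 0 by rewrite mulf_neq0 ?invr_eq0.
rewrite jac_mul_sqr // exprMn.
by case: (qcharP (t / l) F2) tl0 => [->|*|*]; rewrite ?eqxx ?sqrrN ?expr1n ?mul1r.
Qed.

Lemma sum_qchar_sqr_eq (F : finFieldType) (x : F) : 2 != 0 :> F ->
  \sum_y qchar x * qchar y * (x ^+ 2 == y ^+ 2)%:R =
  (x != 0)%:R * (1 + qchar (-1 : F)).
Proof.
move=> F2; have [->|x0] := eqVneq x 0.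
  by rewrite mul0r big1 // => y _; rewrite qchar0 !mul0r.
rewrite (bigD1 x) //= (bigD1 (- x)) /=; last by rewrite eq_sym opp_neq.
rewrite big1 => [|y /andP [yx yNx]].
  rewrite sqrrN !eqxx -!qcharM // -expr2 qchar_sqr //.
  have -> : x * - x = x ^+ 2 * -1 by ring.
  by rewrite qchar_mul_sqr // !mulr1n; ring.
by rewrite eq_sym eqf_sqr (negPf yx) (negPf yNx) mulr0.
Qed.

Lemma sum_neq0 (F : finFieldType) : \sum_(x : F) ((x != 0)%:R : int) = #|F|%:Z - 1.
Proof.
rewrite (eq_bigr (fun x : F => 1 - (x == 0)%:R)) => [|x _]; last by case: eqP.
rewrite sumrB sumr_const natz; congr (_ - _).
by rewrite (bigD1 (0 : F)) //= eqxx big1 // => i /negPf ->.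
Qed.

(** Expand the square and sum over [k] first: [qchar_sum_quadratic] leaves [q [x^2 = y^2] - 1],
    whose second part vanishes by [sum_qchar]. *)
Lemma sum_jac_sqr (F : finFieldType) : 2 != 0 :> F ->
  \sum_(k : F) jac k ^+ 2 = #|F|%:Z * (#|F|%:Z - 1) * (1 + qchar (-1 : F)).
Proof.
move=> F2.
transitivity (\sum_(x : F) \sum_(y : F)
    qchar x * qchar y * \sum_k qchar ((x ^+ 2 + k) * (y ^+ 2 + k))).
  rewrite (eq_bigr (fun k : F => \sum_(x : F) \sum_(y : F)
    qchar x * qchar y * qchar ((x ^+ 2 + k) * (y ^+ 2 + k)))) => [|k _].
    rewrite exchange_big; apply: eq_bigr => x _ /=.
    by rewrite exchange_big; apply: eq_bigr => y _ /=; rewrite mulr_sumr.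
  rewrite expr2 {1}/jac mulr_suml; apply: eq_bigr => x _.
  rewrite mulr_sumr; apply: eq_bigr => y _; rewrite !qcharM //; ring.
transitivity (\sum_(x : F) (#|F|%:Z *
    (\sum_(y : F) qchar x * qchar y * (x ^+ 2 == y ^+ 2)%:R)
    - qchar x * \sum_(y : F) qchar y)).
  apply: eq_bigr => x _; rewrite !mulr_sumr -sumrB; apply: eq_bigr => y _.
  rewrite qchar_sum_quadratic //; ring.
rewrite sum_qchar.
under eq_bigr do rewrite sum_qchar_sqr_eq // mulr0 subr0 mulrCA mulrC.
rewrite -mulr_sumr sum_neq0; ring.
Qed.

Lemma jacobsthal (F : finFieldType) : 2 != 0 :> F -> qchar (-1 : F) = 1 ->
  exists b : int, jac (-1 : F) ^+ 2 + b ^+ 2 = 4 * #|F|%:Z.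
Proof.
move=> F2 m1.
(* Without a nonresidue, all values of [qchar] would be nonnegative with sum 0, contradicting
   [qchar 1 = 1]. *)
have [n n1] : exists n : F, qchar n = -1.
  case: (pickP [pred n : F | qchar n == -1]) => [n /eqP|nsq]; first by exists n.
  have /eqP := sum_qchar F.
  rewrite psumr_eq0 => [|x _]; last by have := nsq x => /=; case: (qcharP x F2).
  by move=> /allP /(_ 1 (mem_index_enum _)); rewrite /= qchar1.
exists (jac n).
have n0 : n != 0 by apply: contra_eqN n1 => /eqP ->; rewrite qchar0.
have N10 : -1 != 0 :> F by rewrite oppr_eq0 oner_eq0.
(* For nonzero [k] the square of [jac k] depends only on [qchar k]; written linearly in [qchar k],
   its second term disappears on summing over [k]. *)
have jE (k : F) : 2 * jac k ^+ 2 = (k != 0)%:R * (jac (-1 : F) ^+ 2 + jac n ^+ 2)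
    + qchar k * (jac (-1 : F) ^+ 2 - jac n ^+ 2).
  have [->|k0] := eqVneq k 0; first by rewrite jac0 qchar0 mulr0n; ring.
  have := @jac_sqr_eq F k _ F2 k0 N10; have := @jac_sqr_eq F k _ F2 k0 n0.
  rewrite m1 n1; case: (qcharP k F2) => [kz|t t0 kE|_ _].
  - by rewrite kz eqxx in k0.
  - by move=> _ ->; rewrite ?mulr1n //; ring.
  - by move=> -> // _; rewrite mulr1n; ring.
have := congr1 (fun z => 2 * z) (sum_jac_sqr F2).
rewrite mulr_sumr; under eq_bigr do rewrite jE.
rewrite big_split /= -!mulr_suml sum_qchar sum_neq0 m1 mul0r addr0 => H.
have q1 : #|F|%:Z - 1 != 0.
  by rewrite subr_eq0 -[1]/(Posz 1) eqz_nat neq_ltn card_finNzRing_gt1 orbT.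
by apply: (mulfI q1); rewrite H; ring.
Qed.

(** * Congruences by counting orbits *)

Lemma dvdn_card_fibres (T : finType) (U : finType) (f : T -> U) (A : pred T) (d : nat) :
  (forall x, A x -> #|[pred y | A y && (f y == f x)]| = d) -> (d %| #|A|)%N.
Proof.
move=> fib; rewrite -sum1_card (partition_big f xpredT) //=.
apply: dvdn_sum => u _; rewrite (sum1_card [pred x | A x && (f x == u)]).
case: (pickP [pred x | A x && (f x == u)]) => [x /= /andP [Ax /eqP <-]|e].
  by rewrite fib.
by rewrite (eq_card0 e).
Qed.

(* Nonempty fibres of [x ^+ 2 + x^-2] on such an [A] are [{x, -x, x^-1, -x^-1}]. *)
Lemma dvdn4_card (F : finFieldType) (A : pred F) : 2 != 0 :> F ->
  (forall x, A x -> [&& x != 0, x ^+ 2 != 1 & x ^+ 2 != -1]) ->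
  (forall x, A x -> A (- x)) -> (forall x, A x -> A x^-1) -> (4 %| #|A|)%N.
Proof.
move=> F2 A0 AN AV; apply: (@dvdn_card_fibres _ _ (fun x => x ^+ 2 + x ^- 2)) => x Ax.
have /and3P [x0 x1 xN1] := A0 x Ax.
pose s := [:: x; - x; x^-1; - x^-1].
have xVx : x != x^-1.
  by apply: contraNneq x1 => xE; rewrite expr2 {1}xE mulVf.
have xNVx : x != - x^-1.
  by apply: contraNneq xN1 => xE; rewrite expr2 {1}xE mulNr mulVf.
have us : uniq s.
  rewrite /= !inE !negb_or !andbT !opp_neq ?invr_eq0 // xVx xNVx eqr_oppLR xNVx /=.
  by rewrite eqr_opp xVx.
rewrite -[RHS](card_uniqP us); apply: eq_card => y; rewrite !inE.
apply/andP/idP => [[Ay /eqP E]|].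
  have /and3P [y0 _ _] := A0 y Ay.
  have : (y ^+ 2 - x ^+ 2) * (y ^+ 2 - x^-1 ^+ 2) == 0.
    have -> : (y ^+ 2 - x ^+ 2) * (y ^+ 2 - x^-1 ^+ 2) =
      y ^+ 2 * ((y ^+ 2 + y ^- 2) - (x ^+ 2 + x ^- 2)) by field; rewrite x0 y0.
    by rewrite E subrr mulr0.
  by rewrite mulf_eq0 !subr_eq0 !eqf_sqr -!orbA.
have EN (z : F) : (- z) ^+ 2 + (- z) ^- 2 = z ^+ 2 + z ^- 2 by rewrite sqrrN.
have EV : x^-1 ^+ 2 + x^-1 ^- 2 = x ^+ 2 + x ^- 2 by rewrite exprVn invrK addrC.
by case/or4P => /eqP ->; rewrite ?EN ?EV ?eqxx; split; auto.
Qed.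

(** These are 0, 1, -1 and the [1 + qchar (-1)] square roots of -1. *)
Lemma card_exceptional (F : finFieldType) : 2 != 0 :> F ->
  #|[pred x : F | ~~ [&& x != 0, x ^+ 2 != 1 & x ^+ 2 != -1]]|%:Z =
  4 + qchar (-1 : F).
Proof.
move=> F2.
pose u := [predU [predU pred1 (0 : F) & pred2 1 (-1)] & [pred x : F | x ^+ 2 == -1]].
rewrite (eq_card (B := u)) => [|x]; last first.
  by rewrite !inE !negb_and !negbK sqrf_eq1 orbA.
have := cardUI [predU pred1 (0 : F) & pred2 1 (-1)] [pred x : F | x ^+ 2 == -1].
have := cardUI (pred1 (0 : F)) (pred2 1 (-1)).
rewrite card1 card2 opp_neq ?oner_eq0 //.
rewrite (@eq_card0 _ [predI pred1 (0 : F) & _]) => [|x]; last first.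
  by rewrite !inE; case: eqP => //= ->; rewrite eq_sym oner_eq0 eq_sym oppr_eq0 oner_eq0.
rewrite (@eq_card0 _ [predI _ & [pred x : F | x ^+ 2 == -1]]) => [|x]; last first.
  rewrite !inE -sqrf_eq1; case: (eqVneq x 0) => [->|_] /=.
    by rewrite expr0n eq_sym oppr_eq0 oner_eq0.
  by case: eqP => //= ->; rewrite (negPf (opp_neq F2 (oner_neq0 _))).
rewrite addn0 => cU; rewrite addn0 cU => cu.
rewrite /u cu PoszD /qchar (_ : Posz (1 + _) = 3) //; ring.
Qed.

(** The elements outside the [4 + qchar (-1)] exceptional ones come in fours by [dvdn4_card]. *)
Lemma qcharN1_card (F : finFieldType) : 2 != 0 :> F ->
  exists m : int, #|F|%:Z - qchar (-1 : F) = 4 * m.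
Proof.
move=> F2; pose A := [pred x : F | [&& x != 0, x ^+ 2 != 1 & x ^+ 2 != -1]].
have /dvdnP [m mE] : (4 %| #|A|)%N.
  apply: dvdn4_card => // x; first by rewrite /= oppr_eq0 sqrrN.
  by rewrite /= invr_eq0 exprVn invr_eq1 (inv_eq (@invrK F) _ (-1)) invrN1.
have /(congr1 Posz) := cardC A.
rewrite mE PoszD PoszM (card_exceptional F2 : Posz #|[predC A]| = _) => qE.
by exists (m%:Z + 1); rewrite -qE; ring.
Qed.

(** On [A] the summand is 1 or -1, so the sum there is [2 |A1| - |A|], where 4 divides [|A1|] and
    [|A| = q - 5]. Off [A] only the two square roots of -1 contribute, 1 each. *)
Lemma jacN1_mod8 (F : finFieldType) : 2 != 0 :> F -> qchar (-1 : F) = 1 ->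
  exists m : int, jac (-1 : F) = 7 - #|F|%:Z + 8 * m.
Proof.
move=> F2 m1; pose f (x : F) := x * (x ^+ 2 - 1).
pose A := [pred x : F | [&& x != 0, x ^+ 2 != 1 & x ^+ 2 != -1]].
pose A1 := [pred x : F | A x && (qchar (f x) == 1)].
have /dvdnP [m mE] : (4 %| #|A1|)%N.
  apply: dvdn4_card => // [x /andP [] //|x|x] /andP [/and3P [x0 x1 xN1]] fx1.
    rewrite /A1 /A /= oppr_eq0 sqrrN x0 x1 xN1 /f sqrrN mulNr -mulN1r qcharM //.
    by rewrite m1 mul1r.
  rewrite /A1 /A /= invr_eq0 exprVn invr_eq1 x0 x1 /=.
  rewrite (inv_eq (@invrK F) _ (-1)) invrN1 xN1 -(eqP fx1) /=.
  (* Here [f (x^-1) = - f x / x^4]. *)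
  apply/eqP; rewrite -[LHS]mul1r -m1 -qcharM // -[RHS](@qchar_mul_sqr F _ (x ^- 2)).
    by rewrite /f; congr qchar; field.
  by rewrite invr_eq0 expf_neq0.
have fA x : A x -> qchar (f x) = 2 * (A1 x)%:R - 1.
  move=> Ax; rewrite /A1 /=; move: (Ax) => /= ->; case/and3P: Ax => x0 x1 _.
  have : f x != 0 by rewrite mulf_neq0 // subr_eq0.
  by case: (qcharP (f x) F2) => [->|//|//]; rewrite eqxx.
have fNA x : ~~ A x -> qchar (f x) = (x ^+ 2 == -1)%:R.
  rewrite !negb_and !negbK; case: (eqVneq (x ^+ 2) (-1)) => [x2 _|_ ].
    (* When [x^2 = -1], both sides equal [-2 x]. *)
    have -> : f x = (1 - x) ^+ 2 by rewrite /f sqrrB x2; ring: x2.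
    rewrite qchar_sqr // subr_eq0; apply/eqP => x1.
    by have := opp_neq F2 (oner_neq0 F); rewrite -x2 -x1 expr1n eqxx.
  rewrite orbF => /orP [] /eqP.
    by rewrite /f => ->; rewrite mul0r qchar0.
  by rewrite /f => ->; rewrite subrr mulr0 qchar0.
have cA := congr1 Posz (cardC A).
rewrite PoszD (card_exceptional F2 : Posz #|[predC A]| = _) m1 in cA.
have cA1 : \sum_(x | A x) (A1 x)%:R = #|A1|%:Z.
  rewrite -natz -sum1_card natr_sum big_mkcond [RHS]big_mkcond /=.
  apply: eq_bigr => x _; rewrite /A1 /in_mem /= /A /=.
  by case: [&& _, _ & _] => //=; case: eqP.
have cNA : \sum_(x | ~~ A x) ((x ^+ 2 == -1)%:R : int) = 1 + qchar (-1 : F).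
  rewrite /qchar addrCA subrr addr0 -natz -sum1_card natr_sum.
  rewrite big_mkcond [RHS]big_mkcond /=.
  apply: eq_bigr => x _; rewrite inE /= !negb_and !negbK.
  by case: (x ^+ 2 == -1); rewrite ?orbT //; case: ifP.
exists m%:Z; rewrite /jac (bigID A) /= (eq_bigr _ fA) (eq_bigr _ fNA) cNA m1.
rewrite sumrB -mulr_sumr cA1 mE sumr_const !natz PoszM -cA.
rewrite -[X in _ - X]/(Posz #|A|); ring.
Qed.

(** * The traces of Frobenius of y^2 = x^3 - x *)

(** Above each [x] lie [1 + qchar (x^3 - x)] affine points; as [qchar] counts roots, this includes
    [p = 2]. *)
Lemma frob_trace_jac (p : nat) : prime p ->
  frob_trace curve_x3_sub_x p = - jac (-1 : 'F_p).
Proof.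
move=> pp; rewrite /frob_trace /card_reduction -addn1 PoszD.
have -> : #|on_weierstrass
      (map_weierstrass (fun z : int => z%:~R : 'F_p) curve_x3_sub_x)|%:Z
    = \sum_(x : 'F_p) #|[pred y : 'F_p | y ^+ 2 == x * (x ^+ 2 - 1)]|%:Z.
  rewrite -(raddf_sum Posz) /=; congr Posz.
  rewrite -sum1_card (partition_big (@fst 'F_p 'F_p) xpredT) //=.
  apply: eq_bigr => x _; rewrite -sum1_card.
  rewrite (reindex_onto (fun y => (x, y)) snd) /= => [|[x' y] /= /andP [_ /eqP ->]] //.
  apply: eq_bigl => y; rewrite !eqxx !andbT unfold_in /= inE.
  by congr (_ == _); rewrite ?(mulr0z, mul0r, addr0, mulrN1z); ring.
rewrite /jac /qchar sumrB sumr_const card_Fp // natz; ring.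
Qed.

Lemma Fp2_neq0 (p : nat) : prime p -> p != 2%N -> 2 != 0 :> 'F_p.
Proof.
by move=> pp p2; rewrite -(dvdn_pcharf (pchar_Fp pp)) dvdn_prime2.
Qed.

(** Squaring is the identity on the field with two elements, so every [qchar] is 0. *)
Lemma frob_trace2 : frob_trace curve_x3_sub_x 2 = 0.
Proof.
rewrite frob_trace_jac // /jac big1 ?oppr0 // => x _; rewrite /qchar.
rewrite (eq_card (B := pred1 (x * (x ^+ 2 - 1)))) ?card1 // => y.
by rewrite !inE; have := expf_card y; rewrite card_Fp // => ->.
Qed.

Lemma frob_trace_spec (p : nat) : prime p ->
  frob_trace curve_x3_sub_x p = 0 /\ ~~ (4 %| p%:Z - 1)%Z \/
  exists a b m k : int, [/\ frob_trace curve_x3_sub_x p = 2 * a,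
    p%:Z = a ^+ 2 + b ^+ 2, 2 * a = p%:Z + 1 + 8 * m & p%:Z = 1 + 4 * k].
Proof.
move=> pp; have [->|p2] := eqVneq p 2%N; first by left; split; first exact: frob_trace2.
have F2 := Fp2_neq0 pp p2; rewrite frob_trace_jac //.
have [k] := qcharN1_card F2; rewrite card_Fp //.
have : -1 != 0 :> 'F_p by rewrite oppr_eq0 oner_eq0.
case: (qcharP (-1 : 'F_p) F2) (@jacobsthal _ F2) (@jacN1_mod8 _ F2)
  (@jac_eq0 _ (-1) F2) => [->|t _ _|_ _].
- by rewrite eqxx.
- move=> /(_ erefl) [b jb] /(_ erefl) [m jm] _ _ pk; right.
  rewrite card_Fp // in jb jm.
  move: (jac _) jb jm => j jb jm.
  (* From [j = 7 - p + 8 m] and [p = 1 + 4 k]. *)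
  have [a aE] : exists a, j = 2 * a by exists (4 * m + 3 - 2 * k); lia.
  have [c cE] : exists c, b = 2 * c.
    by exists (b %/ 2)%Z; subst j; nia.
  (* The trace is [- j = p - 7 - 8 m], that is [p + 1 + 8 (-1 - m)]. *)
  exists (- a), c, (-1 - m), k; split; [lia| |lia|lia].
  subst; lia.
move=> _ _ /(_ erefl) -> _ pk; left; rewrite oppr0; split=> //.
by move: pk; clear; lia.
Qed.

(** * Uniqueness of the representation as a sum of two squares *)

Lemma sum_sqr_even (p : nat) (a b : int) : odd p -> ~~ (2 %| a)%Z ->
  p%:Z = a ^+ 2 + b ^+ 2 -> exists s, b = 2 * s.
Proof.
move=> op oa pab; have [/dvdzP [s ->]|ob] := boolP (2 %| b)%Z; first by exists s; ring.
have [t aE] : exists t, a = 1 + 2 * t by exists (a %/ 2)%Z; move: oa; clear; lia.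
have [s bE] : exists s, b = 1 + 2 * s by exists (b %/ 2)%Z; move: ob; clear; lia.
by move: pab op; rewrite aE bE; clear; lia.
Qed.

(* With [p] dividing [a * d - c * b], the identity
   [p ^ 2 = (a * c + b * d) ^ 2 + (a * d - c * b) ^ 2] leaves only
   [a * d = c * b] or [a * c + b * d = 0], and the latter is excluded by parity. *)
Lemma sum_two_sqr_uniq (p : nat) (a b c d : int) : prime p -> odd p ->
  ~~ (2 %| a)%Z -> ~~ (2 %| c)%Z ->
  p%:Z = a ^+ 2 + b ^+ 2 -> p%:Z = c ^+ 2 + d ^+ 2 -> a ^+ 2 = c ^+ 2.
Proof.
move=> pp op.
(* The product of [a d - c b] and [- a d - c b] is [p (c^2 - a^2)], so [p] divides one of them;
   replacing [d] by [- d] exchanges the two. *)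
wlog dv : d / (p%:Z %| a * d - c * b)%Z => [wl oa oc pab pcd|oa oc pab pcd].
  have : (p%:Z %| (a * d - c * b) * (a * - d - c * b))%Z.
    apply/dvdzP; exists (c ^+ 2 - a ^+ 2).
    have b2 : b ^+ 2 = p%:Z - a ^+ 2 by rewrite pab; ring.
    have d2 : d ^+ 2 = p%:Z - c ^+ 2 by rewrite pcd; ring.
    by transitivity (c ^+ 2 * b ^+ 2 - a ^+ 2 * d ^+ 2); [ring | rewrite b2 d2; ring].
  rewrite !dvdzE abszM Euclid_dvdM // => /orP [] dv.
    by apply: (wl d).
  by apply: (wl (- d)); rewrite ?sqrrN.
have p0 : 0 < p%:Z :> int by have := prime_gt0 pp; lia.
have /dvdzP [q qE] := dv.
have pE : p%:Z ^+ 2 = (a * c + b * d) ^+ 2 + (q * p%:Z) ^+ 2.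
  by rewrite -qE expr2 {1}pab pcd; ring.
have q1 : q ^+ 2 <= 1.
  have : q ^+ 2 * p%:Z ^+ 2 <= 1 * p%:Z ^+ 2.
    by rewrite mul1r [leRHS]pE exprMn lerDr sqr_ge0.
  by rewrite ler_pM2r // exprn_gt0.
have odd_ac : exists u v, a = 1 + 2 * u /\ c = 1 + 2 * v.
  by exists (a %/ 2)%Z, (c %/ 2)%Z; move: oa oc; clear; lia.
have [s bE] := sum_sqr_even op oa pab; have [t dE] := sum_sqr_even op oc pcd.
have [q0|q0] := eqVneq q 0.
  rewrite q0 mul0r in qE.
  have adE : a * d = c * b by apply/eqP; rewrite -subr_eq0 qE.
  have : (p%:Z * a ^+ 2 = p%:Z * c ^+ 2).
    rewrite {1}pcd {1}pab !mulrDl -!exprMn -[d * a]mulrC adE; ring.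
  by apply: mulfI; rewrite gt_eqF.
have q2 : q ^+ 2 = 1.
  have : 0 < q ^+ 2 by rewrite exprn_even_gt0.
  by move: q1; clear; lia.
have : a * c + b * d = 0.
  apply/eqP; rewrite -sqrf_eq0; apply/eqP.
  by move: pE; rewrite exprMn q2 mul1r => /eqP; rewrite -subr_eq subrr => /eqP.
case: odd_ac => u [v [-> ->]]; rewrite bE dE; clear; lia.
Qed.

(** Uniqueness determines [a] up to sign, and the congruence modulo 8 fixes the sign because [a] is
    odd. *)
Lemma frob_traceP (p : nat) (a : int) : prime p -> ~~ (2 %| a)%Z ->
  (frob_trace curve_x3_sub_x p = 2 * a) <->
  exists b m : int, p%:Z = a ^+ 2 + (2 * b) ^+ 2 /\ 2 * a = p%:Z + 1 + 8 * m.
Proof.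
move=> pp oa; have [t aE] : exists t, a = 1 + 2 * t.
  by exists (a %/ 2)%Z; move: oa; clear; lia.
split=> [tr|[b [m [pab am]]]].
  have [[tr0 _]|[c [b [m [k [trc pcb cm pk]]]]]] := frob_trace_spec pp.
    by move: tr aE; rewrite tr0; clear; lia.
  have ca : c = a by move: tr; rewrite trc; clear; lia.
  subst c; have op : odd p by move: pk; clear; lia.
  have [s bE] := sum_sqr_even op oa pcb; exists s, m; split=> //.
  by rewrite -bE.
have op : odd p by move: pab; rewrite aE; clear; lia.
(* As [a] is odd, [2 a = p + 1 + 8 m] forces [p = 1] modulo 4, which excludes the first
   alternative. *)
have [[_ p4]|[c [d [n [k [-> pcd cn pk]]]]]] := frob_trace_spec pp.
  by move: p4 am; rewrite aE; clear; lia.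
have oc : ~~ (2 %| c)%Z by move: cn pk; clear; lia.
have /eqP := sum_two_sqr_uniq pp op oa oc pab pcd.
rewrite eqf_sqr => /orP [] /eqP; first by move=> ->.
by move: aE am cn; clear; lia.
Qed.

(** * Primes of given trace as values of quadratic polynomials *)

Lemma good_reduction_odd (p : nat) : prime p -> odd p ->
  good_reduction curve_x3_sub_x p.
Proof.
move=> pp op; exists curve_x3_sub_x.
  exists 1, 0, 0, 0; split; first exact: oner_neq0.
  by rewrite /=; split; ring.
rewrite (_ : wdisc _ = (2 ^ 6)%N%:Z) //.
by rewrite dvdzE /= Euclid_dvdX // dvdn_prime2 //; case: eqP op => // ->.
Qed.

(** Rules out [m = 0] in [16 m^2 + a^2], since (HL) counts values at [m >= 1]. *)
Lemma prime_neq_sqr (p : nat) (a : int) : prime p -> p%:Z <> a ^+ 2.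
Proof.
move=> pp pa; have pE : p = (`|a| ^ 2)%N by rewrite -abszX -pa.
have /primeP [p1 /(_ `|a|%N)] := pp.
rewrite {1}pE dvdn_exp // => /(_ isT) /orP [] /eqP aE; move: p1; rewrite pE.
  by rewrite aE.
by move: aE; rewrite {1}pE; clear; nia.
Qed.

(** Modulo 8, [2 a = 2] while [p + 1 = 2 + 4 b^2], so [b] is even. The term [0 * m] matches the
    shape of [pi_quadratic]. *)
Lemma trace_quadratic_1mod4 (p : nat) (a t : int) : prime p -> a = 1 + 4 * t ->
  (good_reduction curve_x3_sub_x p /\ frob_trace curve_x3_sub_x p = 2 * a) <->
  exists2 m : int, 1 <= m & p%:Z = 16 * m ^+ 2 + 0 * m + a ^+ 2.
Proof.
move=> pp aE; have oa : ~~ (2 %| a)%Z by rewrite aE; clear; lia.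
split=> [[_ /(frob_traceP pp oa) [b [n [pab an]]]]|[m _ pE]].
  have [/dvdzP [s bE]|ob] := boolP (2 %| b)%Z; last first.
    have [s bE] : exists s, b = 1 + 2 * s by exists (b %/ 2)%Z; move: ob; clear; lia.
    by move: an; rewrite pab bE aE; clear; lia.
  exists `|s|; last by rewrite pab bE real_normK ?num_real //; ring.
  have s0 : s != 0.
    apply/eqP => s0; apply: (prime_neq_sqr (a := a) pp).
    by rewrite pab bE s0; ring.
  by move: s0; clear; lia.
have op : odd p by move: pE; rewrite aE; clear; lia.
split; first exact: good_reduction_odd.
(* The second witness solves [2 a = p + 1 + 8 n] for [n]. *)
apply/(frob_traceP pp oa); exists (2 * m), (- 2 * m ^+ 2 - 2 * t ^+ 2).
split; first by rewrite pE; ring.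
by rewrite pE aE; ring.
Qed.

(** Now [2 a = 6] modulo 8 forces [b] to be odd, and the polynomial is [(4 m - 2)^2 + a^2]
    expanded. *)
Lemma trace_quadratic_3mod4 (p : nat) (a t : int) : prime p -> a = 3 + 4 * t ->
  (good_reduction curve_x3_sub_x p /\ frob_trace curve_x3_sub_x p = 2 * a) <->
  exists2 m : int, 1 <= m & p%:Z = 16 * m ^+ 2 + (- 16) * m + (4 + a ^+ 2).
Proof.
move=> pp aE; have oa : ~~ (2 %| a)%Z by rewrite aE; clear; lia.
split=> [[_ /(frob_traceP pp oa) [b [n [pab an]]]]|[m _ pE]].
  have [/dvdzP [s bE]|ob] := boolP (2 %| b)%Z.
    by move: an; rewrite pab bE aE; clear; lia.
  have [s bE] : exists s, b = 1 + 2 * s by exists (b %/ 2)%Z; move: ob; clear; lia.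
  (* [2 b = 4 s + 2] is [4 m - 2] for [m = s + 1] and [- (4 m - 2)] for [m = - s]; the sign of [s]
     decides which [m] is positive. *)
  have [s0|s0] := lerP 0 s.
    by exists (s + 1); [move: s0; clear; lia | rewrite pab bE; ring].
  by exists (- s); [move: s0; clear; lia | rewrite pab bE; ring].
have op : odd p by move: pE; rewrite aE; clear; lia.
split; first exact: good_reduction_odd.
apply/(frob_traceP pp oa).
exists (2 * m - 1), (2 * m - 2 * m ^+ 2 - 2 * t ^+ 2 - 2 * t - 1).
split; first by rewrite pE; ring.
by rewrite pE aE; ring.
Qed.

(** * The Hardy-Littlewood constant *)

Lemma legendre_mul_sqr (d c : int) (p : nat) : prime p -> ~~ (p%:Z %| c)%Z ->
  legendre (d * c ^+ 2) p = legendre d p.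
Proof.
move=> pp pc; rewrite /legendre.
have -> : (p%:Z %| d * c ^+ 2)%Z = (p%:Z %| d)%Z.
  rewrite !dvdzE abszM abszX Euclid_dvdM // Euclid_dvdX //.
  by move: pc; rewrite dvdzE => /negPf ->; rewrite orbF.
have c0 : c%:~R != 0 :> 'F_p.
  move: pc; rewrite dvdzE (dvdn_pcharf (pchar_Fp pp)); case: c => n //.
  by rewrite NegzE mulrNz oppr_eq0.
case: ifP => // _; congr (if _ then _ else _).
apply/existsP/existsP => [[y /eqP yE]|[y /eqP yE]].
  by exists (y / c%:~R); rewrite expr_div_n yE rmorphM rmorphXn /= mulfK ?expf_neq0.
by exists (y * c%:~R); rewrite exprMn yE rmorphM rmorphXn.
Qed.

Lemma legendre_product_eq (R : realType) (a : int) :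
  legendre_product R (- (8 * a) ^+ 2) (fun p => ~~ (p%:Z %| 2 * 16)%Z) =
  legendre_product R (-1) (fun p => ~~ (p%:Z %| 2 * a)%Z).
Proof.
rewrite /legendre_product; congr (limn _); apply/funext => n.
rewrite big_mkcond [RHS]big_mkcond; apply: eq_bigr => p _ /=.
have [pp|//] := boolP (prime p).
have p32 : (p%:Z %| 2 * 16)%Z = (p == 2%N).
  by rewrite -[(2 * 16)%Z]/((2 ^ 5)%N%:Z) dvdzE Euclid_dvdX // dvdn_prime2 // andbT.
have p2a : (p%:Z %| 2 * a)%Z = (p == 2%N) || (p%:Z %| a)%Z.
  by rewrite !dvdzE abszM Euclid_dvdM // dvdn_prime2.
have p8 : (p%:Z %| (8 * a)%R)%Z = (p == 2%N) || (p%:Z %| a)%Z.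
  by rewrite !dvdzE abszM Euclid_dvdM // (_ : `|8| = 2 ^ 3)%N // Euclid_dvdX //
    dvdn_prime2 // andbT.
rewrite p32 p2a; case: eqVneq p8 => //= _ p8.
have [pa|pa] := boolP (p%:Z %| a)%Z.
  rewrite /legendre rpredN (_ : (p%:Z %| ((8 * a) ^+ 2)%R)%Z) ?mul0r ?subr0 //.
  by rewrite expr2 dvdz_mulr // p8.
by rewrite -[- (8 * a) ^+ 2]mulN1r legendre_mul_sqr // p8.
Qed.

Lemma eq_count_primes (R : realType) (P Q : nat -> Prop) :
  (forall p, prime p -> P p <-> Q p) -> @count_primes R P = count_primes Q.
Proof.
move=> PQ; apply/funext => x; rewrite /count_primes; congr _%:R.
apply: eq_bigl => p; have [pp|//] := boolP (prime p).
by congr (_ && _); apply: asbool_equiv_eq; apply: PQ.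
Qed.

(** Evaluates the (HL) constant for both polynomials: [gcd(2, 16 + b) = 2], [sqrt 16 = 4], and the
    odd part of [gcd(16, b) = 16] is 1, whence [2 / 4 = 1 / 2]. *)
Lemma hardy_littlewood16 (R : realType) (b c a : int) : hardy_littlewood R ->
  (16 %| b)%Z -> ~~ (2 %| a)%Z -> b ^+ 2 - 4 * 16 * c = - (8 * a) ^+ 2 ->
  asymptotic (@pi_quadratic R 16 b c)
    (fun x : R => 1 / 2%:R
          * legendre_product R (-1) (fun p => ~~ (p%:Z %| 2 * a)%Z)
          * (Num.sqrt x / ln x)).
Proof.
move=> HL /dvdzP [e bE] oa disc.
have [t aE] : exists t, a = 1 + 2 * t.
  by exists (a %/ 2)%Z; move: oa; clear; lia.
(* With [b = 16 e], [disc] reads [c = 4 e^2 + a^2]. *)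
have oc : ~~ (2 %| c)%Z by move: disc; rewrite bE aE; clear; lia.
have := HL 16 b c isT; rewrite disc legendre_product_eq.
have g16 : gcdn 16 `|b| = 16%N.
  by apply/gcdn_idPl; rewrite bE abszM dvdn_mull.
have -> : gcdz 2 (16 + b) = 2.
  rewrite /gcdz; congr Posz; apply/gcdn_idPl.
  by rewrite bE -[X in X + _]mul1r -mulrDl abszM dvdn_mull.
have -> : odd_gcd 16 b = 1%N.
  by rewrite /odd_gcd [gcdn _ _]g16 part_p'nat // pnatNK.
rewrite (_ : Num.sqrt (16%:~R : R) = 4%:R); last first.
  by rewrite (_ : 16%:~R = 4%:R ^+ 2 :> R) ?sqrtr_sqr ?ger0_norm // -natrX.
rewrite (_ : 2%:~R / 4 * (1%:R / (totient 1)%:R) = 1 / 2%:R :> R); last first.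
  by rewrite (_ : totient 1 = 1%N) //; field.
apply.
(* The discriminant is negative, as [a] is odd and so nonzero. *)
- move=> [k kE]; have := sqr_ge0 (1 + 2 * t); have := sqr_ge0 k.
  by rewrite -kE aE; clear; lia.
- rewrite /gcdz [X in gcdn `|Posz X|]g16; congr Posz.
  apply/eqP; rewrite -[_ == _]/(coprime (2 ^ 4) _) coprimeXl // prime_coprime //.
- by case=> _ c2; rewrite c2 in oc.
Qed.

Theorem corollary1p6 (R : realType) (r : int) (hr : r != 0) :
  hardy_littlewood R ->
  ((r = 2 %[mod 4])%Z ->
     asymptotic (@pi_trace R curve_x3_sub_x r)
       (fun x : R => 1 / 2%:R
          * legendre_product R (-1) (fun p => ~~ (p%:Z %| r)%Z)
          * (Num.sqrt x / ln x))) /\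
  (~ (r = 2 %[mod 4])%Z ->
     is_bigO (@pi_trace R curve_x3_sub_x r) (fun=> 1)).
Proof.
move=> HL; split=> r4.
  (* The class of the odd number [r / 2] modulo 4 selects the polynomial. *)
  have [t [rE|rE]] : exists t, r = 2 * (1 + 4 * t) \/ r = 2 * (3 + 4 * t).
    exists (r %/ 8)%Z; move: r4; clear; lia.
  - rewrite rE [X in asymptotic X](eq_count_primes R
      (fun p pp => trace_quadratic_1mod4 pp erefl)).
    apply: (hardy_littlewood16 (b := 0)) => //; first by clear; lia.
    ring.
  - rewrite rE [X in asymptotic X](eq_count_primes R
      (fun p pp => trace_quadratic_3mod4 pp erefl)).
    apply: (hardy_littlewood16 (b := -16)) => //; first by clear; lia.
    ring.
(* The count is identically 0: a trace is either 0 or [2 a = p + 1 + 8 m] with [p = 1] modulo 4,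
   hence 2 modulo 4. *)
exists 0; near=> x.
rewrite mul0r normr_le0 /pi_trace /count_primes big1 // => p /andP [pp /asboolP [_ tr]].
exfalso; have [[tr0 _]|[a [b [m [k [tra _ am pk]]]]]] := frob_trace_spec pp.
  by rewrite -tr tr0 eqxx in hr.
by apply: r4; move: tra am pk; rewrite tr; clear; lia.
Unshelve. all: by end_near.
Qed.
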